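(* Let $\ell$ be a positive integer and let $n\ge 2$ be an integer. For the complete graph $K_n$, the number $\tau_\ell(K_n)$ of $\ell$-congruent spanning trees of $K_n$ is $$\tau_{\ell}(K_n) = \frac{1}{\ell^n} \sum_{\substack{k_0+k_1+\cdots+k_{\ell-1}=n \\ k_0,\ldots,k_{\ell-1}\ge 0}} \frac{n!}{k_0!\, k_1! \cdots k_{\ell-1}!} \left( \sum_{p=0}^{\ell-1} k_p\, e^{\frac{2\pi \mathrm{i}}{\ell}p}\right)^{n-2},$$ where the outer sum is over all $\ell$-tuples $(k_0,\ldots,k_{\ell-1})$ of nonnegative integers with sum $n$.
   Context: For a positive integer $\ell$, an $\ell$-congruent tree is a nontrivial tree $T$ (at least two vertices) such that the degrees of all vertices of $T$ are congruent modulo $\ell$; equivalently, $d_T(v)\equiv 1\pmod{\ell}$ for every $v\in V(T)$, where $d_T(v)$ is the degree of $v$ in $T$. An $\ell$-congruent spanning tree of a graph $G$ is a spanning tree of $G$ that is an $\ell$-congruent tree. $\tau_\ell(G)$ denotes the number of $\ell$-congruent spanning trees of $G$, where the vertices of $G$ are labelled (spanning trees are counted as distinct subgraphs, not up to isomorphism). $K_n$ is the complete graph on $n$ vertices, $\mathrm{i}$ is the imaginary unit, and the convention $0^0=1$ is used. *)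

(* Defs.v *)
From HB Require Import structures.
From mathcomp Require Import all_boot all_order all_algebra.
From mathcomp Require Import boolp reals sequences exp trigo.
From mathcomp Require Import complex.

Set Implicit Arguments.
Unset Strict Implicit.
Unset Printing Implicit Defensive.

Import Order.TTheory GRing.Theory Num.Theory.
Local Open Scope ring_scope.
Local Open Scope complex_scope.

Record sgraph (V : finType) := SGraph {
  adj :> rel V;
  adj_sym : symmetric adj;
  adj_irr : irreflexive adj
}.

Section Graphs.
Variable V : finType.
Implicit Types (G : sgraph V) (F : {set {set V}}).

Definition edges G : {set {set V}} :=
  [set e | [exists x, exists y, G x y && (e == [set x; y])]].

(* The spanning subgraph with edge set F; only the two-element members of F
   matter, and every member has two elements when F \subset edges G. *)
Definition edge_rel F : rel V := fun x y => (x != y) && ([set x; y] \in F).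

Lemma edge_rel_sym F : symmetric (edge_rel F).
Proof. by move=> x y; rewrite /edge_rel eq_sym setUC. Qed.

Lemma edge_rel_irr F : irreflexive (edge_rel F).
Proof. by move=> x; rewrite /edge_rel eqxx. Qed.

Definition spanning_subgraph F : sgraph V :=
  SGraph (@edge_rel_sym F) (@edge_rel_irr F).

Definition degree G (x : V) : nat := #|[set y | G x y]|.

Definition connected_graph G : Prop :=
  (0 < #|V|)%N /\ forall x y, connect G x y.

(* A cycle needs at least three vertices: ucycle also accepts the empty
   sequence and the back-and-forth walk [:: x; y] along an edge. *)
Definition acyclic G : Prop :=
  forall s : seq V, (2 < size s)%N -> ~ ucycle G s.

Definition is_tree G : Prop := connected_graph G /\ acyclic G.

Definition congruent_tree (l : nat) G : Prop :=
  [/\ is_tree G, (1 < #|V|)%N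
    & forall u v : V, degree G u = degree G v %[mod l]].

Definition tau (l : nat) G : nat :=
  #|[set F : {set {set V}} | (F \subset edges G) &&
       `[< congruent_tree l (spanning_subgraph F) >]]|.

Lemma complete_sym : symmetric (fun x y : V => x != y).
Proof. by move=> x y; rewrite eq_sym. Qed.

Lemma complete_irr : irreflexive (fun x y : V => x != y).
Proof. by move=> x; rewrite eqxx. Qed.

Definition complete : sgraph V := SGraph complete_sym complete_irr.

End Graphs.

Definition complete_graph (n : nat) : sgraph 'I_n := complete 'I_n.

(* The complex exponential, by Euler's formula. *)
Definition Cexp (R : realType) (z : R[i]) : R[i] :=
  (expR (complex.Re z))%:C *
  (cos (complex.Im z) +i* sin (complex.Im z)).

(* Main.v *)
Require Import Defs.
From HB Require Import structures.
From mathcomp Require Import all_boot all_order all_algebra.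
From mathcomp Require Import boolp reals sequences exp trigo.
From mathcomp Require Import complex.

Set Implicit Arguments.
Unset Strict Implicit.
Unset Printing Implicit Defensive.

Import Order.TTheory GRing.Theory Num.Theory.
Local Open Scope ring_scope.
Local Open Scope complex_scope.

(** The proof counts trees by their degrees, in the manner of Cayley and
    Prufer.  For a vertex set A with at least two elements and e : V -> nat
    vanishing off A, the trees on A in which every v has degree e(v) + 1 are
    as many as the words of length #|A| - 2 in which every letter v occurs
    e(v) times (card_trees).  Both numbers obey the same recursion.  A word
    splits into its first letter u and a shorter word with one u less
    (card_wordsS).  On the tree side, take v in A with e(v) = 0: it is a leaf,
    and removing it leaves a tree on A \ v in which the degree of its
    neighbour u has dropped by one (card_trees_leaf).  If no such v exists,
    there is no tree, because a tree has a leaf (exists_leaf), and no word,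
    because the e(v) add up to more than the length.

    Having a leaf, a tree has all its degrees congruent modulo l exactly when
    they are all 1 modulo l.  Hence tau_l(K_n) is the number of words w of
    length n - 2 over the n vertices in which every letter occurs a multiple
    of l times (tau_complete).  With z a primitive l-th root of unity,
    \sum_(p < l) z^(p c) is l if l divides c and 0 otherwise, so
      l^n tau_l(K_n) = \sum_w \prod_v \sum_(p < l) z^(p #{i | w_i = v}).
    Expanding the product as a sum over f : V -> 'I_l turns this into
      \sum_f \sum_w \prod_i z^(f(w_i)) = \sum_f (\sum_v z^(f v))^(n - 2)
    (tau_complete_sum).  The summand depends only on the sizes k_p of the
    fibres of f, and the number of f with given sizes is again a number of
    words, the multinomial coefficient (card_words). *)

(** * Words with prescribed letter counts *)

Section Words.
Variable T : finType.
Implicit Types (e : T -> nat) (u v : T).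

Lemma big_tupleS (R : Type) (idx : R) (op : Monoid.com_law idx) m
    (F : m.+1.-tuple T -> R) :
  \big[op/idx]_w F w =
  \big[op/idx]_a \big[op/idx]_(w : m.-tuple T) F [tuple of a :: w].
Proof.
rewrite pair_big /=.
rewrite (reindex (fun p : T * m.-tuple T => [tuple of p.1 :: p.2])) //=.
exists (fun w => (thead w, [tuple of behead w])) => [[a w] _|w _] /=.
  by congr pair; apply/val_inj.
by rewrite -tuple_eta.
Qed.

Lemma sum_tuple_prod (R : comNzRingType) (x : T -> R) m :
  \sum_(w : m.-tuple T) \prod_(a <- w) x a = (\sum_a x a) ^+ m.
Proof.
elim: m => [|m IHm].
  rewrite (bigD1 [tuple]) //= big_nil big1 ?addr0 ?expr0 // => w.
  by case/eqP; apply: tuple0.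
rewrite big_tupleS exprS -IHm mulr_suml; apply: eq_bigr => a _.
by rewrite mulr_sumr; apply: eq_bigr => w _; rewrite big_cons.
Qed.

Lemma prod_seq_count (R : comNzRingType) (x : T -> R) (s : seq T) :
  \prod_(a <- s) x a = \prod_a x a ^+ count_mem a s.
Proof.
elim: s => [|b s IHs].
  by rewrite big_nil big1.
rewrite big_cons IHs [in RHS](bigD1 b) //= [in LHS](bigD1 b) //= eqxx add1n.
rewrite exprS mulrA; congr (_ * _); apply: eq_bigr => a ab.
by rewrite eq_sym (negbTE ab).
Qed.

Lemma sum_seq_count (M : nmodType) (x : T -> M) (s : seq T) :
  \sum_(a <- s) x a = \sum_a x a *+ count_mem a s.
Proof.
elim: s => [|b s IHs]; first by rewrite big_nil big1.
rewrite big_cons IHs [in RHS](bigD1 b) //= [in LHS](bigD1 b) //= eqxx mulrS addrA.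
by congr (_ + _); apply: eq_bigr => a ab; rewrite eq_sym (negbTE ab).
Qed.

Lemma sum_count_mem (s : seq T) : (\sum_a count_mem a s = size s)%N.
Proof.
elim: s => [|b s IHs] /=; first by rewrite big1.
rewrite big_split /= IHs (bigD1 b) //= eqxx big1 ?addn0 // => a ab.
by rewrite eq_sym (negbTE ab).
Qed.

Definition words m e : {set m.-tuple T} :=
  [set w : m.-tuple T | [forall v, count_mem v w == e v]].

Definition lower e u : T -> nat := fun v => (e v - (u == v))%N.

Lemma in_wordsS m e u (w : m.-tuple T) :
  ([tuple of u :: w] \in words m.+1 e) =
  (0 < e u)%N && (w \in words m (lower e u)).
Proof.
rewrite !inE; apply/forallP/andP => [h|[eu /forallP h] v] /=.
  have := h u; rewrite /= eqxx => /eqP <-; split=> //.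
  by apply/forallP=> v; rewrite /lower -(eqP (h v)) /= addKn.
rewrite (eqP (h v)) /lower; case: (u =P v) => [<-|_] /=.
  by rewrite add1n subn1 prednK.
by rewrite subn0.
Qed.

(** The recursion on the first letter, which trees will be shown to share. *)
Lemma card_wordsS m e :
  #|words m.+1 e| = (\sum_(u | 0 < e u) #|words m (lower e u)|)%N.
Proof.
rewrite -sum1_card big_mkcond big_tupleS [RHS]big_mkcond /=.
apply: eq_bigr => u _; under eq_bigr do rewrite in_wordsS.
case: ifP => _; last by rewrite big1.
by rewrite -big_mkcond sum1_card.
Qed.

Lemma card_words0 e : #|words 0 e| = [forall v, e v == 0%N].
Proof.
rewrite -sum1_card big_mkcond (bigD1 [tuple]) //= big1 => [|w]; last first.
  by case/eqP; apply: tuple0.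
rewrite addn0 inE.
have -> : [forall v, count_mem v [tuple] == e v] = [forall v, e v == 0%N].
  by apply: eq_forallb => v; rewrite /= eq_sym.
by case: ifP.
Qed.

Lemma card_words_neq m e : (\sum_v e v != m)%N -> #|words m e| = 0%N.
Proof.
move=> em; apply: eq_card0 => w; rewrite inE; apply/negP => /forallP h.
move: em; rewrite -[X in _ != X](size_tuple w) -sum_count_mem.
by rewrite (eq_bigr _ (fun v _ => esym (eqP (h v)))) eqxx.
Qed.

(** The multinomial coefficient.  After multiplication by the factorials of
    the e(v), the recursion on the first letter u contributes e(u) times m!,
    and the e(u) add up to m + 1. *)
Lemma card_words m e : (\sum_v e v = m)%N ->
  (#|words m e| * \prod_v (e v)`! = m`!)%N.
Proof.
elim: m e => [|m IHm] e em.
  have e0 v : e v = 0%N.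
    by apply/eqP; have /eqP := em; rewrite sum_nat_eq0 => /forallP /(_ v).
  rewrite card_words0 big1 => [|v _]; rewrite ?e0 // muln1.
  by case: forallP => // -[] v; rewrite e0.
rewrite card_wordsS big_distrl /= factS -[in RHS]em big_distrl /= big_mkcond.
apply: eq_bigr => u _; case: posnP => [->//|eu].
rewrite -(IHm (lower e u)); last first.
  apply/eqP; rewrite -eqSS -em /lower (bigD1 u) //= eqxx [in X in _ == X](bigD1 u) //=.
  rewrite subn1 -addSn prednK //; apply/eqP; congr addn; apply: eq_bigr => v uv.
  by rewrite eq_sym (negbTE uv) subn0.
rewrite mulnCA; congr muln.
rewrite (bigD1 u) //= [in RHS](bigD1 u) //= mulnA; congr muln.
  by rewrite /lower eqxx subn1 -[in LHS](prednK eu) factS prednK.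
by apply: eq_bigr => v uv; rewrite /lower eq_sym (negbTE uv) subn0.
Qed.

End Words.

(** * Trees on a subset of the vertices *)

Section Trees.
Variable V : finType.
Implicit Types (A : {set V}) (F : {set {set V}}) (u v x y : V) (e : V -> nat).
Local Notation deg F := (degree (spanning_subgraph F)).

Definition pairs A : {set {set V}} := [set p : {set V} | (p \subset A) && (#|p| == 2)].

(** Trees live on a subset A of a fixed vertex type, so that deleting a leaf
    changes A and not the type; vertices off A are isolated. *)
Definition tree_on A F : Prop :=
  [/\ F \subset pairs A,
      {in A &, forall x y, connect (edge_rel F) x y}
    & acyclic (spanning_subgraph F)].

(** Degrees are shifted by one so that e is the exponent of the monomial of
    the tree in the weighted Cayley formula, and a leaf has e(v) = 0. *)
Definition trees A e : {set {set {set V}}} :=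
  [set F | `[< tree_on A F >] && [forall v in A, deg F v == (e v).+1]].

Lemma edge_rel_in A F x y : F \subset pairs A -> edge_rel F x y ->
  (x \in A) /\ (y \in A).
Proof.
move=> /subsetP FA /andP[_ /FA]; rewrite inE => /andP[/subsetP xyA _].
by split; apply: xyA; rewrite !inE eqxx ?orbT.
Qed.

Lemma degree_gt0 A F x : (1 < #|A|)%N -> tree_on A F -> x \in A -> (0 < deg F x)%N.
Proof.
move=> A1 [_ Fc _] xA.
have /card_gt0P [y] : (0 < #|A :\ x|)%N by rewrite (cardsD1 x) xA in A1.
rewrite !inE => /andP[yx yA].
have /connectP [[|z p] /=] := Fc x y xA yA.
  by move=> _ yE; rewrite yE eqxx in yx.
by move=> /andP[xz _] _; apply/card_gt0P; exists z; rewrite inE.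
Qed.

(** Otherwise every vertex has two neighbours and a simple path can always be
    extended at its head: the head x has a neighbour z other than its successor
    y, and z cannot lie further along the path without closing a cycle.  There
    would be simple paths of every length in a finite graph. *)
Lemma exists_leaf A F : (1 < #|A|)%N -> tree_on A F ->
  exists2 v, v \in A & deg F v = 1%N.
Proof.
move=> A1 FT; have [FA Fc Fa] := FT.
have [[v vA v1]|noleaf] := pselect (exists2 v, v \in A & deg F v = 1%N).
  by exists v.
have deg2 x y : x \in A -> edge_rel F x y -> exists2 z, z != y & edge_rel F x z.
  move=> xA xy.
  have /set0Pn [z] : [set z | edge_rel F x z] :\ y != set0.
    apply/eqP => h; apply: noleaf; exists x => //.
    by rewrite /degree (cardsD1 y) h cards0 inE /= xy.
  by rewrite !inE => /andP[zy xz]; exists z.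
have long k : exists x y p, [/\ x \in A, size p = k,
    path (edge_rel F) x (y :: p) & uniq [:: x, y & p]].
  elim: k => [|k [x [y [p [xA sp xyp Up]]]]].
    have /card_gt0P [x xA] : (0 < #|A|)%N by exact: ltnW.
    have /card_gt0P [y] := degree_gt0 A1 FT xA; rewrite inE /= => xy.
    exists x, y, [::]; split=> //=; first by rewrite xy.
    by rewrite inE andbT; case/andP: xy.
  have /andP [xy _] := xyp.
  have [z zy xz] := deg2 x y xA xy.
  have zx : z != x by move: xz; rewrite /edge_rel eq_sym => /andP[].
  have [zp|zp] := boolP (z \in p).
    exfalso.
    move: xyp Up; case/path.splitP: zp => p1 p2.
    rewrite -!cat_cons cat_path cat_uniq => /andP[h1 _] /andP[u1 _].
    apply: (Fa (x :: y :: rcons p1 z)); first by rewrite /= size_rcons.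
    rewrite /ucycle u1 andbT (cycle_path x).
    rewrite [last _ _]last_rcons /= in h1 *.
    by rewrite h1 andbT edge_rel_sym.
  exists z, x, (y :: p); split.
  - by have [] := edge_rel_in FA xz.
  - by rewrite /= sp.
  - by apply/andP; split=> //; rewrite edge_rel_sym.
  - by rewrite cons_uniq Up andbT !inE !negb_or zx zy zp.
have [x [y [p [_ sp _ Up]]]] := long #|V|.
have := uniq_leq_size Up (fun z _ => mem_enum V z).
by rewrite /= -cardE sp ltnNge leqnSn.
Qed.

(** Attaching a new leaf v to the vertex u of a graph on A. *)
Section Leaf.
Variables (A : {set V}) (F : {set {set V}}) (u v : V).
Hypotheses (uA : u \in A) (vA : v \notin A) (FA : F \subset pairs A).
Let F' := [set u; v] |: F.

Lemma leaf_neq : u != v.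
Proof. by apply: contraNneq vA => <-. Qed.

Lemma edge_rel_add_leaf x y : edge_rel F' x y =
  [|| edge_rel F x y, (x == u) && (y == v) | (x == v) && (y == u)].
Proof.
rewrite /edge_rel !inE; have [->|xy] /= := eqVneq x y.
  by rewrite andbC orbb; case: eqP => // ->; rewrite eq_sym (negbTE leaf_neq).
rewrite orbC; congr orb; apply/eqP/idP => [E|].
  have : x \in [set u; v] by rewrite -E !inE eqxx.
  have : y \in [set u; v] by rewrite -E !inE eqxx orbT.
  by rewrite !inE => /orP[] /eqP yE /orP[] /eqP xE; move: xy; rewrite xE yE !eqxx ?orbT.
by case/orP => /andP[/eqP-> /eqP->] //; rewrite setUC.
Qed.

Lemma edge_rel_outside x : edge_rel F x v = false.
Proof.
by apply/negP => /(edge_rel_in FA) [_]; rewrite (negbTE vA).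
Qed.

Lemma degree_add_leaf x : deg F' x = ((u == x) + (v == x) + deg F x)%N.
Proof.
rewrite /degree; have [ux|ux] := eqVneq u x.
  have -> : [set y | spanning_subgraph F' x y] = v |: [set y | spanning_subgraph F x y].
    apply/setP => y; rewrite !inE /= edge_rel_add_leaf -ux eqxx.
    by rewrite (negbTE leaf_neq) orbF orbC.
  by rewrite cardsU1 inE /= edge_rel_outside -ux eq_sym (negbTE leaf_neq).
have [vx|vx] := eqVneq v x.
  have -> : [set y | spanning_subgraph F' x y] = u |: [set y | spanning_subgraph F x y].
    apply/setP => y; rewrite !inE /= edge_rel_add_leaf -vx eqxx.
    by rewrite (eq_sym v) (negbTE leaf_neq) /= orbC.
  by rewrite cardsU1 inE /= edge_rel_sym -vx edge_rel_outside.
congr #|pred_of_set _|; apply/setP => y; rewrite !inE /= edge_rel_add_leaf.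
by rewrite !(eq_sym x) (negbTE ux) (negbTE vx) orbF.
Qed.

Lemma leaf_edge_notin : [set u; v] \notin F.
Proof.
apply/negP => /(subsetP FA); rewrite inE => /andP[/subsetP /(_ v)].
by rewrite !inE eqxx orbT (negbTE vA) => /(_ isT).
Qed.

(** Folding v onto u maps walks of the enlarged graph to walks of the original
    one, so connectedness survives the removal of v.  Acyclicity survives its
    addition since the two neighbours of v on a cycle would both be u. *)
Lemma tree_add_leaf : tree_on (v |: A) F' <-> tree_on A F.
Proof.
have subF : subrel (edge_rel F) (edge_rel F').
  by move=> x y xy; rewrite edge_rel_add_leaf xy.
have neq z : z \in A -> (z == v) = false.
  by move=> zA; apply: contraNF vA => /eqP <-.
split=> -[F'A Fc Fa]; split=> //.
- pose h z := if z == v then u else z.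
  have hstep x y : edge_rel F' x y -> connect (edge_rel F) (h x) (h y).
    rewrite edge_rel_add_leaf => /or3P[xy|/andP[/eqP-> /eqP->]|/andP[/eqP-> /eqP->]].
    + have [xA yA] := edge_rel_in FA xy.
      by rewrite /h !neq //; apply: connect1.
    + by rewrite /h eqxx (negbTE leaf_neq).
    + by rewrite /h eqxx (negbTE leaf_neq).
  have hconn x y : connect (edge_rel F') x y -> connect (edge_rel F) (h x) (h y).
    case/connectP=> p; elim: p x => [|z p IHp] x /=; first by move=> _ ->.
    by case/andP=> /hstep xz /IHp zy /zy; apply: connect_trans.
  move=> x y xA yA.
  have := hconn x y (Fc x y (setU1r v xA) (setU1r v yA)).
  by rewrite /h !neq.
- move=> s s2 /andP[sc su]; apply: (Fa s s2).
  by rewrite /ucycle su (sub_cycle subF sc).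
- apply/subsetP => p; rewrite !inE => /orP[/eqP->|/(subsetP FA)].
    by rewrite cards2 leaf_neq subUset !sub1set !inE uA eqxx orbT.
  by rewrite inE => /andP[pA ->]; rewrite (subset_trans pA) // subsetU1.
- have sym : connect_sym (edge_rel F').
    by apply: sym_connect_sym => x y; apply: edge_rel_sym.
  have toA z : z \in v |: A -> exists2 w, w \in A & connect (edge_rel F') z w.
    rewrite !inE => /orP[/eqP->|zA]; last by exists z.
    by exists u => //; apply: connect1; rewrite edge_rel_add_leaf !eqxx !orbT.
  move=> x y /toA [x' x'A xx'] /toA [y' y'A yy'].
  apply: connect_trans xx' _; rewrite sym; apply: connect_trans yy' _; rewrite sym.
  by apply: connect_sub (Fc x' y' x'A y'A) => a b /subF; apply: connect1.
- move=> s s2 /andP[sc su].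
  have [vs|vs] := boolP (v \in s); last first.
    apply: (Fa s s2); rewrite /ucycle su andbT.
    apply: (sub_in_cycle (P := [pred z | z != v])) sc; last first.
      by apply/allP => z zs; apply: contraNneq vs => <-.
    move=> x y /= xv yv; rewrite !inE in xv yv *.
    by rewrite edge_rel_add_leaf (negbTE xv) (negbTE yv) andbF !orbF.
  (* Rotated to start at v, the cycle reads v, a, b, ..., so that both a and
     the last vertex are neighbours of v, that is u. *)
  have [i [|a [|b p]] sE] := rot_to vs.
  + by rewrite -(size_rot i) sE in s2.
  + by rewrite -(size_rot i) sE in s2.
  + have onlyu z : edge_rel F' z v -> z = u.
      rewrite edge_rel_add_leaf edge_rel_outside /= eqxx andbT.
      by rewrite (eq_sym v) (negbTE leaf_neq) andbF orbF => /eqP.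
    move: sc su; rewrite -(rot_cycle i) -(rot_uniq i) sE (cycle_path v).
    rewrite [last _ _]/= => /= /and3P[/onlyu lu va _].
    rewrite edge_rel_sym in va; rewrite (onlyu _ va).
    by rewrite -lu mem_last !andbF.
Qed.
End Leaf.

(** The analogue of in_wordsS, with the neighbour u of the leaf in the role of
    the first letter.  That e(u) is positive comes from #|A| > 2: u has
    another neighbour besides v. *)
Lemma in_trees_add_leaf A F e u v : (2 < #|A|)%N -> v \in A -> u \in A :\ v ->
  F \subset pairs (A :\ v) -> e v = 0%N ->
  ([set u; v] |: F \in trees A e) =
  (0 < e u)%N && (F \in trees (A :\ v) (lower e u)).
Proof.
move=> A2 vA uA FA ev.
have vA' : v \notin A :\ v by rewrite !inE eqxx.
have uv := leaf_neq uA vA'.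
have A'1 : (1 < #|A :\ v|)%N by rewrite (cardsD1 v) vA in A2.
rewrite /trees !inE andbCA.
have -> : `[< tree_on A ([set u; v] |: F) >] = `[< tree_on (A :\ v) F >].
  apply: asbool_equiv_eq; rewrite -{1}(setD1K vA); exact: tree_add_leaf.
case: (asboolP (tree_on _ _)) => //= FT.
have du := degree_gt0 A'1 FT uA.
have dv : deg F v = 0%N.
  by apply: eq_card0 => y; rewrite inE /= edge_rel_sym (edge_rel_outside vA' FA) .
apply/forall_inP/andP => [h|[eu /forall_inP h] x xA].
  have eu : (0 < e u)%N.
    have := h u; rewrite (degree_add_leaf uA vA' FA) eqxx (eq_sym v) (negbTE uv).
    have uA0 : u \in A by move: uA; rewrite inE => /andP[].
    by move=> /(_ uA0) /eqP [] <-.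
  split=> //; apply/forall_inP => x; rewrite !inE => /andP[xv xA].
  have := h x xA; rewrite (degree_add_leaf uA vA' FA) (eq_sym v) (negbTE xv) addn0 /lower.
  case: (u =P x) => [<-|_]; last by rewrite subn0.
  by rewrite add1n eqSS subn1 prednK.
rewrite (degree_add_leaf uA vA' FA).
have [->|xv] := eqVneq x v; first by rewrite (negbTE uv) dv ev.
have := h x; rewrite !inE xv xA => /(_ isT) /eqP ->.
rewrite addn0 /lower.
case: (u =P x) => [<-|_]; last by rewrite subn0.
by rewrite add1n eqSS subn1 prednK.
Qed.

(** Since v has degree one, each tree is counted once by its edges at v; the
    trees containing the edge uv are those on A \ v with that edge added. *)
Lemma card_trees_leaf A e v : (2 < #|A|)%N -> v \in A -> e v = 0%N ->
  (forall x, x \notin A -> e x = 0%N) ->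
  #|trees A e| = (\sum_(u | 0 < e u) #|trees (A :\ v) (lower e u)|)%N.
Proof.
move=> A2 vA ev eA.
have vA' : v \notin A :\ v by rewrite !inE eqxx.
have in_edge F u : F \in trees A e -> edge_rel F v u ->
    [/\ u \in A :\ v, F :\ [set u; v] \subset pairs (A :\ v)
      & [set u; v] |: (F :\ [set u; v]) = F].
  rewrite inE => /andP[/asboolP [FA _ _] /forall_inP dF] vu.
  have [_ uA] := edge_rel_in FA vu.
  have uv : u != v by case/andP: vu; rewrite eq_sym.
  have uvF : [set u; v] \in F by case/andP: vu => _; rewrite setUC.
  split; rewrite ?setD1K //; first by rewrite !inE uv.
  apply/subsetP => p; rewrite !inE => /andP[puv pF].
  have := subsetP FA p pF; rewrite inE => /andP[pA p2]; rewrite p2 andbT.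
  rewrite subsetD1 pA /=; apply/negP => vp.
  have : (#|p :\ v| == 1)%N by move: p2; rewrite (cardsD1 v) vp.
  case/cards1P => w pw.
  have pE : p = [set w; v] by rewrite -(setD1K vp) pw setUC.
  have wv : w != v by have := set11 w; rewrite -pw !inE => /andP[].
  have := dF v vA; rewrite ev /degree (cardsD1 u) inE /= vu /=.
  rewrite eqSS cards_eq0 => /eqP/setP/(_ w); rewrite !inE /=.
  have -> : edge_rel F v w by rewrite /edge_rel eq_sym wv setUC -pE.
  by rewrite andbT => /negbFE /eqP wu; rewrite pE wu eqxx in puv.
(* The inner sum is the degree of v, which is 1. *)
transitivity (\sum_(F in trees A e) \sum_u edge_rel F v u)%N.
  rewrite -sum1_card; apply: eq_bigr => F; rewrite inE => /andP[_ /forall_inP /(_ v vA)].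
  rewrite ev => /eqP <-; rewrite /degree -sum1_card big_mkcond.
  by apply: eq_bigr => u _; rewrite inE.
rewrite exchange_big [RHS]big_mkcond /=; apply: eq_bigr => u _.
rewrite -big_mkcondr /= sum1_card.
case: ifP => eu; last first.
  apply: eq_card0 => F; rewrite -topredE /=; apply/negP => /andP[FT vu].
  have [uA FA FE] := in_edge F u FT vu.
  by move: FT; rewrite -FE in_trees_add_leaf // eu.
have uA : u \in A :\ v.
  rewrite !inE; apply/andP; split; first by apply: contraTneq eu => ->; rewrite ev.
  by apply: contraTT eu => /eA ->.
have treesP F : F \in trees (A :\ v) (lower e u) -> F \subset pairs (A :\ v).
  by rewrite inE => /andP[/asboolP []].
rewrite -[RHS](card_in_imset (f := fun F => [set u; v] |: F)) => [|F1 F2 F1T F2T];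
  last first.
  move=> /(congr1 (fun F => F :\ [set u; v])).
  rewrite /= !setU1K //.
    exact: leaf_edge_notin (treesP _ F2T).
  exact: leaf_edge_notin (treesP _ F1T).
apply: eq_card => F; rewrite -topredE /=; apply/andP/imsetP => [[FT vu]|[F0 F0T ->]].
  have [_ FA FE] := in_edge F u FT vu; exists (F :\ [set u; v]) => //.
  by move: FT; rewrite -{1}FE in_trees_add_leaf // => /andP[].
rewrite in_trees_add_leaf // ?eu ?F0T; last exact: treesP.
by split=> //; rewrite (edge_rel_add_leaf F0 uA vA') !eqxx !orbT.
Qed.

(** The refined Cayley formula, by induction on #|A|.  The only tree on two
    vertices is a single edge, obtained by adding a leaf to a point. *)
Theorem card_trees A e : (1 < #|A|)%N -> (forall x, x \notin A -> e x = 0%N) ->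
  #|trees A e| = #|words (#|A| - 2) e|.
Proof.
move: {2}(#|A| - 2)%N (erefl (#|A| - 2)%N) => m.
elim: m A e => [|m IHm] A e Am A1 eA.
  have /cards2P [a [b [ab AE]]] : #|A| == 2%N by rewrite eqn_leq A1 andbT -subn_eq0 Am.
  have [bb ba] : b \in [set b] /\ a \notin [set b] by rewrite !inE eqxx.
  have s0 : set0 \subset pairs [set b] by rewrite sub0set.
  pose F0 := [set b; a] |: set0.
  have T0 : tree_on A F0.
    rewrite AE; apply/(tree_add_leaf bb ba s0); split=> // [x y|s s2 /andP[]].
      by rewrite !inE => /eqP-> /eqP->.
    by case: s s2 => [|x [|y s]] //= _; rewrite /edge_rel inE andbF.
  have d0 x : deg F0 x = (x \in A) :> nat.
    rewrite (degree_add_leaf bb ba s0) AE !inE !(eq_sym x).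
    have -> : deg set0 x = 0%N.
      by apply: eq_card0 => y; rewrite !inE /= /edge_rel inE andbF.
    by case: (a =P x) => [<-|_]; rewrite ?(eq_sym b) ?(negbTE ab) //= !addn0.
  have uniqF F : tree_on A F -> F = F0.
    move=> FT; have [FA _ _] := FT.
    have aA : a \in A by rewrite AE !inE eqxx.
    have FE p : p \in F -> p = [set b; a].
      move/(subsetP FA); rewrite inE => /andP[pA /eqP p2]; rewrite setUC -AE.
      by apply/eqP; rewrite eqEcard pA p2 AE cards2 ab.
    have /card_gt0P [c] := degree_gt0 A1 FT aA; rewrite inE => /andP[_ acF].
    apply/setP => p; rewrite !inE orbF; apply/idP/eqP => [/FE //|->].
    by rewrite -(FE _ acF).
  rewrite Am card_words0; case: forallP => [e0|e0] /=.
    apply/eqP/cards1P; exists F0; apply/setP => F; rewrite !inE.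
    apply/andP/eqP => [[/asboolP/uniqF //]|->]; split; first exact/asboolP.
    by apply/forall_inP => x xA; rewrite d0 xA (eqP (e0 x)).
  apply: eq_card0 => F; rewrite inE; apply/negP => /andP[/asboolP/uniqF -> /forall_inP dF].
  case: e0 => x; have [xA|/eA->//] := boolP (x \in A).
  by have := dF x xA; rewrite d0 xA eqSS eq_sym.
have A2 : (2 < #|A|)%N by rewrite -subn_gt0 Am.
have [[v vA ev]|noz] := pselect (exists2 v, v \in A & e v = 0%N).
  have cA : #|A :\ v| = #|A|.-1 by rewrite (cardsD1 v A) vA.
  have cm : (#|A :\ v| - 2 = m)%N by rewrite cA -subn1 subnAC Am subn1.
  rewrite (card_trees_leaf A2 vA ev eA) Am card_wordsS.
  apply: eq_bigr => u eu; rewrite IHm ?cm //.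
    by rewrite cA -ltnS prednK // ltnW // ltnW.
  move=> x; rewrite !inE /lower negb_and negbK => /orP[/eqP->|/eA->] //.
  by rewrite ev.
(* All e(v) are positive on A: a tree would lack a leaf, and the letter counts
   would add up to at least #|A|, more than the length #|A| - 2. *)
rewrite card_words_neq ?Am.
  apply: eq_card0 => F; rewrite inE; apply/negP => /andP[/asboolP FT /forall_inP dF].
  have [v vA v1] := exists_leaf A1 FT; apply: noz; exists v => //.
  by have := dF v vA; rewrite v1 => /eqP [].
rewrite neq_ltn; apply/orP; right.
apply: (@leq_trans #|A|); first by rewrite -Am -subn_gt0 subKn.
rewrite -sum1_card [leqRHS](bigID (mem A)) /= -[leqLHS]addn0 leq_add //.
by apply: leq_sum => v vA; rewrite lt0n; apply/eqP => ev; apply: noz; exists v.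
Qed.
End Trees.

(** * Congruent spanning trees of a complete graph *)

Section Congruent.
Variable V : finType.
Hypothesis V_gt1 : (1 < #|V|)%N.
Local Notation deg F := (degree (spanning_subgraph F)).

Lemma edges_complete : edges (complete V) = pairs [set: V].
Proof.
apply/setP => p; rewrite !inE subsetT; apply/existsP/cards2P.
  by case=> x /existsP [y /andP [xy /eqP pE]]; exists x, y.
case=> x [y [xy pE]]; exists x; apply/existsP; exists y.
by rewrite /= xy pE eqxx.
Qed.

(** A leaf forces the common residue of the degrees to be 1. *)
Lemma congruent_tree_complete l (F : {set {set V}}) :
  (F \subset edges (complete V)) && `[< congruent_tree l (spanning_subgraph F) >] =
  `[< tree_on setT F >] && [forall v, (l %| (deg F v).-1)%N].
Proof.
rewrite edges_complete.
have V1 : (1 < #|[set: V]|)%N by rewrite cardsT.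
apply/andP/andP => [[FV /asboolP[[[_ Fc] Fa] _ dF]]|[/asboolP FT /forallP dF]].
  have FT : tree_on setT F by split=> // x y _ _; exact: Fc.
  split; first exact/asboolP.
  have [v _ v1] := exists_leaf V1 FT.
  apply/forallP => x; rewrite -subn1 -eqn_mod_dvd ?(degree_gt0 V1 FT) ?inE //.
  by rewrite -v1; apply/eqP/dF.
have [FV Fc Fa] := FT; split=> //; apply/asboolP; split=> //.
  by split=> //; split=> [|x y]; [exact: ltnW|apply: Fc; rewrite inE].
have d1 v : deg F v = 1 %[mod l].
  by apply/eqP; rewrite eqn_mod_dvd ?subn1 ?(degree_gt0 V1 FT) ?inE.
by move=> u v; rewrite !d1.
Qed.

Lemma card_fibers (S E : finType) (A : {set S}) (f : S -> E) :
  #|A| = (\sum_e #|[set x in A | f x == e]|)%N.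
Proof.
rewrite -sum1_card (partition_big f xpredT) //=; apply: eq_bigr => e _.
by rewrite -sum1_card; apply: eq_bigl => x; rewrite inE.
Qed.

(** Trees are sorted by the vector of their degrees minus one and words by
    their vector of letter counts; card_trees matches the classes, and the
    divisibility condition depends on the class only. *)
Lemma tau_complete l :
  tau l (complete V) =
  #|[set w : (#|V| - 2).-tuple V | [forall v, (l %| count_mem v w)%N]]|.
Proof.
pose N := #|V|.
pose dF (F : {set {set V}}) := [ffun v => inord (deg F v).-1 : 'I_N.+1].
pose dw (w : (N - 2).-tuple V) := [ffun v => inord (count_mem v w) : 'I_N.+1].
rewrite /tau (card_fibers _ dF) [RHS](card_fibers _ dw); apply: eq_bigr => e _.
have dFE F v : dF F v = (deg F v).-1 :> nat.
  by rewrite ffunE inordK // ltnS (leq_trans (leq_pred _)) // max_card.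
have dwE w v : dw w v = count_mem v w :> nat.
  by rewrite ffunE inordK // ltnS (leq_trans (count_size _ _)) // size_tuple leq_subr.
have -> : [set F in [set F : {set {set V}} | (F \subset edges (complete V)) &&
      `[< congruent_tree l (spanning_subgraph F) >]] | dF F == e] =
    if [forall v, (l %| e v)%N] then trees setT (fun v => e v) else set0.
  apply/setP => F; rewrite !inE congruent_tree_complete.
  have [le|le] := ifPn.
    rewrite inE; case: (asboolP (tree_on _ F)) => //= FT.
    apply/andP/forall_inP => [[_ /eqP <-] v _|dFe].
      by rewrite dFE prednK // (degree_gt0 _ FT) ?cardsT ?inE.
    have FE : dF F = e.
      by apply/ffunP => v; apply: val_inj; rewrite /= dFE (eqP (dFe v _)) ?inE.
    split; last exact/eqP.
    by apply/forallP => v; rewrite -dFE FE; move: v; exact/forallP.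
  rewrite inE; apply/negP => /andP[/andP[_ /forallP dl] /eqP FE].
  by case/negP: le; apply/forallP => v; rewrite -FE dFE.
have -> : [set w in [set w : (#|V| - 2).-tuple V |
      [forall v, (l %| count_mem v w)%N]] | dw w == e] =
    if [forall v, (l %| e v)%N] then words (#|V| - 2) (fun v => e v) else set0.
  apply/setP => w; rewrite !inE.
  have [le|le] := ifPn.
    rewrite inE; apply/andP/forallP => [[_ /eqP <-] v|we]; first by rewrite dwE.
    have wE : dw w = e.
      by apply/ffunP => v; apply: val_inj; rewrite /= dwE (eqP (we v)).
    split; last exact/eqP.
    by apply/forallP => v; rewrite -dwE wE; move: v; exact/forallP.
  rewrite inE; apply/negP => /andP[/forallP dl /eqP wE].
  by case/negP: le; apply/forallP => v; rewrite -wE dwE.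
case: ifP => _; last by rewrite !cards0.
by rewrite card_trees ?cardsT // => x; rewrite inE.
Qed.
End Congruent.

(** * The filter by roots of unity *)

Lemma sum_prim_root (R : fieldType) l (z : R) c : l.-primitive_root z ->
  \sum_(p < l) z ^+ (p * c) = (if (l %| c)%N then l%:R else 0).
Proof.
move=> zl; under eq_bigr do rewrite mulnC exprM.
rewrite (prim_order_dvd zl); have [->|zc1] := eqVneq (z ^+ c) 1.
  under eq_bigr do rewrite expr1n.
  by rewrite sumr_const card_ord.
apply/eqP; have /eqP := subrX1 (z ^+ c) l.
rewrite -exprM mulnC exprM (prim_expr_order zl) expr1n subrr eq_sym mulf_eq0.
by rewrite subr_eq0 (negbTE zc1).
Qed.

Lemma tau_complete_sum (R : fieldType) (V : finType) l (z : R) :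
  (1 < #|V|)%N -> l.-primitive_root z ->
  (tau l (complete V))%:R * l%:R ^+ #|V| =
  \sum_(f : {ffun V -> 'I_l}) (\sum_v z ^+ f v) ^+ (#|V| - 2).
Proof.
move=> V1 zl; under eq_bigr do rewrite -sum_tuple_prod.
rewrite exchange_big /= tau_complete // -sum1_card natr_sum mulr_suml big_mkcond.
apply: eq_bigr => w _.
transitivity (\prod_v \sum_(p < l) z ^+ (p * count_mem v w)); last first.
  rewrite bigA_distr_bigA /=; apply: eq_bigr => f _.
  by rewrite [RHS]prod_seq_count; apply: eq_bigr => v _; rewrite exprM.
under eq_bigr do rewrite sum_prim_root //.
rewrite inE; case: forallP => [h|/forallP].
  by under eq_bigr do rewrite h; rewrite prodr_const mul1r.
rewrite negb_forall => /existsP[v /negbTE lv].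
by rewrite (bigD1 v) //= lv mul0r.
Qed.

(** Listing its values makes f a word of length n over 'I_l, and the sum of
    x over these values depends only on the letter counts. *)
Lemma sum_ffun_words (R : comNzRingType) l n (G : R -> R) (x : 'I_l -> R) :
  \sum_(f : {ffun 'I_n -> 'I_l}) G (\sum_v x (f v)) =
  \sum_(k : {ffun 'I_l -> 'I_n.+1})
    #|words n (fun p => k p)|%:R * G (\sum_p (k p)%:R * x p).
Proof.
rewrite (reindex (fun t : n.-tuple 'I_l => [ffun i => tnth t i])) /=; last first.
  exists (fun f : {ffun 'I_n -> 'I_l} => [tuple f i | i < n]) => [t _|f _].
    by apply: eq_from_tnth => i; rewrite tnth_mktuple ffunE.
  by apply/ffunP => i; rewrite ffunE tnth_mktuple.
rewrite (partition_big (fun t : n.-tuple 'I_l =>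
  [ffun p => inord (count_mem p t) : 'I_n.+1]) xpredT) //=.
apply: eq_bigr => k _.
rewrite mulr_natl -sumr_const.
apply: eq_big => [t|t /eqP kE].
  rewrite inE; apply/eqP/forallP => [<- p|h].
    by rewrite ffunE inordK // ltnS (leq_trans (count_size _ _)) ?size_tuple.
  by apply/ffunP => p; apply: val_inj; rewrite ffunE (eqP (h p)) inord_val.
congr G; under eq_bigr do rewrite ffunE.
rewrite -(big_tuple _ _ t xpredT x) sum_seq_count.
apply: eq_bigr => p _; rewrite -kE ffunE inordK ?mulr_natl //.
by rewrite ltnS (leq_trans (count_size _ _)) ?size_tuple.
Qed.

(** * The complex exponential at multiples of 2 pi i / l *)

Section Root.
Variable R : realType.

Lemma CexpD (z w : R[i]) : Cexp (z + w) = Cexp z * Cexp w.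
Proof.
case: z w => [a b] [c d]; rewrite /Cexp /= expRD cosD sinD.
rewrite rmorphM /= mulrACA; congr (_ * _).
by simpc; rewrite [in X in _ +i* X]addrC; congr (_ +i* _); rewrite mulrC (mulrC (cos b)).
Qed.

Lemma Cexp0 : Cexp (0 : R[i]) = 1.
Proof. by rewrite /Cexp /= expR0 cos0 sin0 mul1r. Qed.

Lemma CexpX (z : R[i]) p : Cexp (z * p%:R) = Cexp z ^+ p.
Proof.
elim: p => [|p IHp]; first by rewrite mulr0 Cexp0.
by rewrite -natr1 mulrDr mulr1 CexpD IHp exprSr.
Qed.

Lemma Cexp_imaginary (x : R) : Cexp (x%:C * 'i) = cos x +i* sin x.
Proof.
have -> : x%:C * 'i = Complex 0 x by simpc.
by rewrite /Cexp /= expR0 mul1r.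
Qed.

Lemma Cexp_root l p : Cexp ((2 * pi)%:C * 'i%C / l%:R * p%:R) =
  Cexp (((2 * pi / l%:R * p%:R) : R)%:C * 'i).
Proof.
have -> : (2 * pi / l%:R * p%:R : R)%:C = (2 * pi)%:C / l%:R * p%:R.
  by rewrite rmorphM rmorphM /= fmorphV !rmorph_nat.
by rewrite (mulrAC _ 'i) (mulrAC _ 'i).
Qed.

(** A power j with 0 < j < l has real part cos (2t) for t = j pi / l.  Were it
    1, sin t would vanish, although 0 < t < pi. *)
Lemma prim_root_Cexp l : (0 < l)%N ->
  l.-primitive_root (Cexp ((2 * pi)%:C * 'i%C / l%:R) : R[i]).
Proof.
move=> l0; set z := Cexp _.
have zX p : z ^+ p = cos (2 * pi / l%:R * p%:R) +i* sin (2 * pi / l%:R * p%:R).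
  by rewrite -CexpX Cexp_root Cexp_imaginary.
have lr : (0 < l%:R :> R) by rewrite ltr0n.
rewrite /primitive_root_of_unity l0; apply/forallP => i /=.
rewrite unity_rootE.
have [->|il] := eqVneq i.+1 l.
  rewrite zX divfK; last by rewrite gt_eqF.
  have -> : 2 * pi = pi *+ 2 :> R by rewrite mulr_natl.
  by rewrite cos2pi sin2pi eqxx.
have {}il : (i.+1 < l)%N by rewrite ltn_neqAle il ltn_ord.
rewrite eqbF_neg; apply/negP => /eqP; rewrite zX => -[].
pose t : R := pi / l%:R * i.+1%:R.
have -> : 2 * pi / l%:R * i.+1%:R = t *+ 2 :> R by rewrite /t -!mulrA mulr_natl.
have st : 0 < sin t.
  apply: sin_gt0_pi; rewrite /t -mulrA gtr_pMr ?pi_gt0 //.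
  rewrite mulr_gt0 ?pi_gt0 ?divr_gt0 ?mulr_gt0 ?invr_gt0 ?ltr0n //= mulrC.
  by rewrite ltr_pdivrMr // mul1r ltr_nat.
rewrite cos_mulr2n => /eqP; rewrite subr_eq -mulr2n eqrMn2r /= => /eqP ct _.
have /eqP := cos2Dsin2 t.
by rewrite ct -subr_eq0 addrAC subrr add0r expf_eq0 /= gt_eqF.
Qed.
End Root.

(** * The formula *)

Theorem theorem1p11 (R : realType) (l n : nat) (hl : (0 < l)%N)
    (hn : (2 <= n)%N) :
  (tau l (complete_graph n))%:R =
  (l%:R ^+ n)^-1 *
  \sum_(k : {ffun 'I_l -> 'I_n.+1} | (\sum_(p < l) k p == n)%N)
    (n`!%:R / (\prod_(p < l) (k p)`!)%:R) *
    (\sum_(p < l) (k p)%:R * Cexp ((2 * pi)%:C * 'i%C / l%:R * p%:R)) ^+ (n - 2)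
  :> R[i].
Proof.
set z : R[i] := Cexp ((2 * pi)%:C * 'i%C / l%:R).
have zl : l.-primitive_root z by exact: prim_root_Cexp.
have V1 : (1 < #|'I_n|)%N by rewrite card_ord.
have := tau_complete_sum V1 zl; rewrite card_ord => tauE.
have ln0 : l%:R ^+ n != 0 :> R[i] by rewrite expf_neq0 // pnatr_eq0 -lt0n.
apply: (mulIf ln0); rewrite tauE mulrAC mulVf // mul1r.
rewrite (sum_ffun_words n (fun y => y ^+ (n - 2)) (fun p : 'I_l => z ^+ p)).
rewrite [RHS]big_mkcond /=; apply: eq_bigr => k _.
case: eqP => [kn|/eqP kn]; last by rewrite card_words_neq ?mul0r.
rewrite -[in RHS](card_words kn) natrM mulfK.
  by congr (_ * _ ^+ _); apply: eq_bigr => p _; rewrite CexpX.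
by rewrite pnatr_eq0 -lt0n prodn_gt0 // => p; apply: fact_gt0.
Qed.
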